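(* Let $p$ be a prime, $q=p^l$, $m\ge1$, $n=2m$. Let $0\leqslant r\leqslant n(q-1)-2$ and write $r=\rho(q-1)+s$ with $0\leqslant\rho\leqslant n-1$, $0\leqslant s<q-1$. Let $I\subseteq M_{r+1}$. Denote by $\mathrm{dist}$ the minimum Hamming distance. \begin{enumerate} \item If $\rho=n-1$ and $\{q-1-s-1\}\cap I=\emptyset$, then $\mathrm{dist}(\mathcal{C}_q(r+1,I,n))=q-s$. \item Let $0\leqslant\rho\leqslant n-2$. If either $\rho$ is odd and $\{q-1-s+1,\,q-1-s-1\}\cap I=\emptyset$, or $\rho$ is even and $\{|s+1|,|s-1|\}\cap I=\emptyset$, then $\mathrm{dist}(\mathcal{C}_q(r+1,I,n))=(q-s)q^{n-\rho-1}$. If either $\rho$ is odd and $\{q-1-s+1,\,q-1-s-1\}\cap I=\{q-1-s+1\}$, or $\rho$ is even, $s\neq0$ and $\{|s+1|,|s-1|\}\cap I=\{|s-1|\}$, then $\mathrm{dist}(\mathcal{C}_q(r+1,I,n))\geqslant(q^2-qs-1)q^{n-\rho-2}$. \end{enumerate}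
   Context: Let $N=q^n-1$ and $\alpha$ a primitive element of $\mathbb{F}_{q^n}$. Every integer $0\le u\le q^n-1$ is written $u=\sum_{i=0}^{n-1}u_iq^i$, $u_i\in\{0,\dots,q-1\}$; $\mathrm{wt}_q(u)=\sum u_i$, $O(u)=\sum_{i\text{ odd}}u_i$, $E(u)=\sum_{i\text{ even}}u_i$. For $-1\le r<n(q-1)$, $Z_r=\{\alpha^u\mid 0<u\le q^n-1,\ \mathrm{wt}_q(u)\le n(q-1)-r-1\}$. For $0\le r\le n(q-1)$ and integer $k\ge0$, $\Theta^{(r)}_k=\{\alpha^u\mid 0\le u\le q^n-1,\ \mathrm{wt}_q(u)=n(q-1)-r,\ |O(u)-E(u)|=k\}$. $M_r$ is the set of even (resp. odd) integers $k\in[0,m(q-1)]$ when $r$ is even (resp. odd). For $0\le r<n(q-1)$ and $I\subseteq M_r$: $\overline I=M_r\setminus I$, $Z_{r,I}=Z_r\cup\bigcup_{k\in\overline I}\Theta^{(r)}_k$. A cyclic code of length $N$ over $\mathbb{F}_q$ with zero set $Z$ is $\{(c_0,\dots,c_{N-1})\in\mathbb{F}_q^N\mid \sum_ic_i\beta^i=0\ \forall\beta\in Z\}$. $\mathcal{C}_q(r,I,n)^*$ is the cyclic code with zero set $Z_{r,I}$ and $\mathcal{C}_q(r,I,n)$ its extended code (append the coordinate $-\sum_ic_i$). By convention, $\mathcal{C}_q(n(q-1),I,n)$ equals the extended code of the cyclic code with zero set $Z_{n(q-1)-1}$ if $0\notin I$, and $\mathbb{F}_q^{q^n}$ if $0\in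 I$. *)

(* Defs.v *)
From mathcomp Require Import all_boot all_order all_algebra all_field.
Set Implicit Arguments. Unset Strict Implicit. Unset Printing Implicit Defensive.
Import GRing.Theory.
Local Open Scope ring_scope.

Definition digit (q u i : nat) : nat := ((u %/ q ^ i) %% q)%N.
Definition wtq (q n u : nat) : nat := (\sum_(i < n) digit q u i)%N.
Definition Oq (q n u : nat) : nat := (\sum_(i < n | odd i) digit q u i)%N.
Definition Eq (q n u : nat) : nat := (\sum_(i < n | ~~ odd i) digit q u i)%N.
Definition absdiff (a b : nat) : nat := ((a - b) + (b - a))%N.

Definition inM (q m r k : nat) : bool := (k <= m * (q - 1))%N && (odd k == odd r).

Section Codes.
Variables (L : finFieldType) (alpha : L) (q n : nat).

Definition inZ (r : nat) (b : L) : bool :=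
  [exists u : 'I_(q ^ n), (0 < u)%N && (wtq q n u + r + 1 <= n * (q - 1))%N
                          && (b == alpha ^+ u)].

Definition inTheta (r k : nat) (b : L) : bool :=
  [exists u : 'I_(q ^ n), (wtq q n u == n * (q - 1) - r)%N
     && (absdiff (Oq q n u) (Eq q n u) == k) && (b == alpha ^+ u)].

Definition inZI (m r : nat) (I : pred nat) (b : L) : bool :=
  inZ r b || [exists k : 'I_(m * (q - 1)).+1, inM q m r k && ~~ I k && inTheta r k b].

Definition Nlen : nat := (q ^ n).-1.

(* F_q is the subfield {x | x^q = x} of L = F_{q^n} *)
Definition inFq (x : L) : bool := x ^+ q == x.

Definition cyclic_code (Z : pred L) : pred {ffun 'I_Nlen -> L} :=
  fun c => [forall i, inFq (c i)]
           && [forall b, Z b ==> (\sum_(i < Nlen) c i * b ^+ i == 0)].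

Definition extend (c : {ffun 'I_Nlen -> L}) : {ffun 'I_Nlen.+1 -> L} :=
  [ffun i => oapp c (- \sum_(j < Nlen) c j) (unlift ord_max i)].

Definition extended_code (Z : pred L) : pred {ffun 'I_Nlen.+1 -> L} :=
  fun x => [exists c, cyclic_code Z c && (x == extend c)].

End Codes.

Definition Cq (L : finFieldType) (alpha : L) (q m r : nat) (I : pred nat) :=
  @extended_code L q (2 * m) (inZI alpha q (2 * m) m r I).
Arguments Cq {L} alpha q m r I _.

Definition hamming (L : finFieldType) (k : nat) (x y : {ffun 'I_k -> L}) : nat :=
  #|[pred i | x i != y i]|.

(* minimum Hamming distance between distinct codewords
   (convention: the length k if the code has fewer than two words) *)
Definition mindist (L : finFieldType) (k : nat) (C : pred {ffun 'I_k -> L}) : nat :=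
  \big[minn/k]_(x | C x) \big[minn/k]_(y | C y && (y != x)) hamming x y.

(* Main.v *)
(** The lower bounds are BCH bounds.  With k = n - rho - 1, the integer
    U = (q - s) q^k - 1 has weight one more than the largest weight d of an
    exponent in the zero set, and every smaller integer has weight at most d.
    Those of weight exactly d are the U - q^i with i <= k, for which |O - E|
    takes only the two values excluded from I; so alpha^0, ..., alpha^(U-1) are
    all zeros.  If one of the two values lies in I, the run of zeros still
    reaches U - q^(k-1).  For equality, take the functions w + t b |-> g(t) with
    w in an F_q-subspace W of dimension k, b outside W, and g of degree s with s
    roots in F_q: they are orthogonal to every x^u with u of weight at most d,
    whatever I is. *)
Require Import Defs.
From mathcomp Require Import all_boot all_order all_algebra all_field.
From mathcomp Require Import zify ring.
Set Implicit Arguments. Unset Strict Implicit. Unset Printing Implicit Defensive.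
Import GRing.Theory.

(** * Base-q digits: weight and the sums over odd and even positions *)

Lemma half_uphalfM (k a : nat) : k * a = k./2 * a + uphalf k * a.
Proof.
by rewrite -mulnDl uphalf_half; congr (_ * _); have := odd_double_half k; lia.
Qed.

Lemma odd_absdiff (a b : nat) : odd (absdiff a b) = odd (a + b).
Proof. by rewrite /absdiff; lia. Qed.

Lemma wtq_OqEq (q n u : nat) : wtq q n u = Oq q n u + Eq q n u.
Proof. by rewrite /wtq (bigID (fun i : 'I_n => odd i)). Qed.

Lemma wtq_low (q n u : nat) : wtq q n.+1 u = u %% q + wtq q n (u %/ q).
Proof.
rewrite /wtq big_ord_recl /digit expn0 divn1; congr (_ + _).
by apply: eq_bigr => i _; rewrite expnS divnMA.
Qed.

Lemma Oq_high (q n u : nat) :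
  Oq q n.+1 u = Oq q n u + (if odd n then digit q u n else 0).
Proof. by rewrite /Oq big_mkcond big_ord_recr -big_mkcond. Qed.

Lemma Eq_high (q n u : nat) :
  Eq q n.+1 u = Eq q n u + (if odd n then 0 else digit q u n).
Proof.
by rewrite /Eq big_mkcond big_ord_recr -big_mkcond /=; case: (odd n).
Qed.

Lemma digit_small (q u i : nat) : u < q ^ i -> digit q u i = 0.
Proof. by move=> lt_u; rewrite /digit divn_small ?mod0n. Qed.

Lemma digit_le (q u i : nat) : 0 < q -> digit q u i <= q - 1.
Proof. by move=> q0; have := ltn_pmod (u %/ q ^ i) q0; rewrite -/(digit q u i); lia. Qed.

Lemma OqEq_widen (q k n u : nat) : 0 < q -> k <= n -> u < q ^ k ->
  (Oq q n u = Oq q k u) * (Eq q n u = Eq q k u).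
Proof.
move=> q0 /subnKC<- lt_u; elim: (n - k) => [|i IH]; first by rewrite addn0.
rewrite addnS Oq_high Eq_high !IH digit_small ?if_same ?addn0 //.
by rewrite (leq_trans lt_u) // leq_pexp2l // leq_addr.
Qed.

Lemma OqEq_le (q k u : nat) : 0 < q ->
  Oq q k u <= k./2 * (q - 1) /\ Eq q k u <= uphalf k * (q - 1).
Proof.
move=> q0; elim: k => [|k [IO IE]]; first by rewrite /Oq /Eq !big_ord0.
have := digit_le u k q0.
rewrite Oq_high Eq_high (_ : k.+1./2 = uphalf k) // (_ : uphalf k.+1 = k./2.+1) //.
rewrite uphalf_half in IE *; case: (odd k) IE => /= IE; nia.
Qed.

(* c is the digit deficit of u below position k; each missing unit costs u at
   most q ^ (k - 1) (everything is multiplied by q to allow k = 0). *)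
Lemma digit_deficit (q k u c : nat) : 0 < q -> wtq q k u + c = k * (q - 1) ->
  (u %/ q ^ k).+1 * q ^ k.+1 <= q * u.+1 + c * q ^ k.
Proof.
move=> q0; elim: k u c => [|k IH] u c.
  by rewrite /wtq big_ord0 mul0n => /eqP; rewrite addn_eq0 => /andP[_ /eqP->];
     rewrite expn0 expn1 divn1 mulnC mul0n addn0.
rewrite wtq_low mulSn => Hc.
have Hm := ltn_pmod u q0; have Hu := divn_eq u q.
have wle : wtq q k (u %/ q) <= k * (q - 1).
  have [Ole Ele] := OqEq_le k (u %/ q) q0.
  by rewrite wtq_OqEq half_uphalfM leq_add.
have /IH : wtq q k (u %/ q) + (c - (q - 1 - u %% q)) = k * (q - 1).
  move: (u %% q) (wtq _ _ _) Hm wle Hc => a0 w. lia.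
rewrite -divnMA -expnS.
have c_ge : q - 1 - u %% q <= c by lia.
have qk0 : 0 < q ^ k by rewrite expn_gt0 q0.
move: (u %/ q ^ k.+1).+1 => t.
rewrite !expnS; move: (u %% q) (u %/ q) (q ^ k) Hm Hu c_ge qk0 => a0 a1 Q Hm -> c_ge qk0 H.
(* Additive witnesses replace truncated subtraction: [e] units are missing from the lowest digit,
   [c1] from the others. *)
have [c1 Ec] : exists c1, c = c1 + (q - 1 - a0) by exists (c - (q - 1 - a0)); lia.
have [e Ee] : exists e, q = a0 + e + 1 by exists (q - 1 - a0); lia.
move: H; rewrite Ec addnK; have -> : q - 1 - a0 = e by lia.
move=> H.
have H2 : q * (t * (q * Q)) <= q * (q * a1.+1 + c1 * Q) by rewrite leq_mul2l H orbT.
have H3 : q * e <= e * (q * Q) by nia.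
nia.
Qed.

(* (q - s) q^k - 1 has digits q-1, ..., q-1, q-1-s; the smaller integers of
   weight one less arise from it by lowering a single digit, either one whose
   position has the parity of k, or not. *)
Lemma weight_below (q n k s j : nat) : k < n -> s < q - 1 ->
  j.+1 < (q - s) * q ^ k ->
  wtq q n j <= k * (q - 1) + (q - 2 - s) /\
  (wtq q n j = k * (q - 1) + (q - 2 - s) ->
   (if odd k then absdiff (Oq q n j) (Eq q n j) = s + 1
    else absdiff (Oq q n j) (Eq q n j) = q - 2 - s) \/
   (q * ((q - s) * q ^ k) <= q * j.+1 + q ^ k /\
    (if odd k then absdiff (Oq q n j) (Eq q n j) = absdiff s 1
    else absdiff (Oq q n j) (Eq q n j) = q - s))).
Proof.
move=> ltkn lts ltj.
have q0 : 0 < q by lia.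
have qk0 : 0 < q ^ k by rewrite expn_gt0 q0.
have ltj1 : j < q ^ k.+1.
  by rewrite expnS; apply: (leq_trans (ltnW ltj)); rewrite leq_mul2r leq_subr orbT.
have tq : j %/ q ^ k < q - s by rewrite ltn_divLR //; lia.
have dk : digit q j k = j %/ q ^ k by rewrite /digit modn_small //; lia.
have [WO WE] := OqEq_widen q0 ltkn ltj1.
have [Ole Ele] := OqEq_le k j q0.
have ek := half_uphalfM k (q - 1).
have ok : uphalf k * (q - 1) = (if odd k then q - 1 else 0) + k./2 * (q - 1).
  by rewrite uphalf_half; case: (odd k); lia.
have Hdef := @digit_deficit q k j (k * (q - 1) - wtq q k j) q0.
have {Hdef} : (j %/ q ^ k).+1 * q ^ k.+1 <=
    q * j.+1 + (k * (q - 1) - wtq q k j) * q ^ k.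
  by apply: Hdef; rewrite wtq_OqEq; lia.
rewrite !wtq_OqEq WO WE Oq_high Eq_high dk {WO WE dk}.
move: (Oq q k j) (Eq q k j) Ole Ele ek ok => o e Ole Ele -> ok.
rewrite ok in Ele *.
move: (k./2 * _) Ole Ele {ok} => K Ole Ele.
set t := j %/ q ^ k in tq *.
rewrite expnS.
set odk := odd k in Ele *.
have -> : K + ((if odk then q - 1 else 0) + K) - (o + e) =
          K + K + (if odk then q - 1 else 0) - (o + e) by lia.
move=> Hdef.
(* With leading digit q-1-s over full lower digits, [j] would be at least (q-s)q^k - 1. *)
have nofull : o + e = K + K + (if odk then q - 1 else 0) -> t = q - 1 - s -> False.
  move=> Eoe Et; move: Hdef; rewrite Eoe subnn mul0n addn0 Et.
  have -> : (q - 1 - s).+1 = q - s by lia.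
  by rewrite mulnCA leq_pmul2l // leqNgt ltj.
have onelow : o + e + 1 = K + K + (if odk then q - 1 else 0) -> t = q - 1 - s ->
   q * ((q - s) * q ^ k) <= q * j.+1 + q ^ k.
  move=> Eoe Et; move: Hdef; rewrite -Eoe addKn mul1n Et.
  have -> : (q - 1 - s).+1 = q - s by lia.
  by rewrite mulnCA.
clear Hdef ltj1 ltj; clearbody t.
rewrite /absdiff; case: odk Ele nofull onelow => Ele nofull onelow.
all: split; [lia|] => Hw.
(* A leading digit other than q-1-s must be q-2-s over full lower digits. Otherwise exactly one
   lower unit is missing, and the parity of its position selects the alternative. *)
all: have [Et|ne] := eqVneq t (q - 1 - s); last by left; lia.
all: have F : q * ((q - s) * q ^ k) <= q * j.+1 + q ^ k by apply: onelow => //; lia.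
all: by have [Eo|nEo] := eqVneq o K; [right + left | left + right]; lia.
Qed.

(** * The minimum distance as a bounded minimum *)

(** The default [k] is the starting value of the fold, not a neutral element of [minn], so it
    contributes the condition [D <= k]. *)
Lemma bigminn_geP (T : finType) (P : pred T) (F : T -> nat) (k D : nat) :
  reflect (D <= k /\ forall x, P x -> D <= F x) (D <= \big[minn/k]_(x | P x) F x).
Proof.
apply: (iffP idP) => [H|[Dk DF]]; last first.
  by elim/big_ind: _ => // a b Da Db; rewrite leq_min Da.
suff {H} : forall r : seq T, D <= \big[minn/k]_(x <- r | P x) F x ->
    D <= k /\ forall x, x \in r -> P x -> D <= F x.
  by move/(_ _ H) => [-> DF]; split => // x; apply: DF; rewrite mem_index_enum.
elim=> [|y r IH]; first by rewrite big_nil.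
rewrite big_cons; case: ifPn => Py; rewrite ?leq_min => H.
  case/andP: H => DFy /IH[-> DF]; split=> // x /predU1P[->//|]; exact: DF.
by have [-> DF] := IH H; split=> // x /predU1P[->|]; [rewrite (negPf Py)|exact: DF].
Qed.

Lemma mindist_geP (L : finFieldType) (k : nat) (C : pred {ffun 'I_k -> L}) (D : nat) :
  reflect (D <= k /\ forall x y, C x -> C y -> y != x -> D <= hamming x y)
          (D <= mindist C).
Proof.
apply: (iffP (bigminn_geP _ _ _ _)) => -[Dk H]; split=> // x.
  by move=> y Cx Cy xy; have /bigminn_geP[_] := H x Cx; apply; rewrite Cy.
by move=> Cx; apply/bigminn_geP; split=> // y /andP[Cy xy]; apply: H.
Qed.

(** * The BCH bound *)

Local Open Scope ring_scope.

(* The BCH bound: test f against the polynomial vanishing at all points of its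
   support but one. *)
Lemma bch_bound (L : fieldType) (T : finType) (e f : T -> L) (D : nat) (i0 : T) :
  injective e -> f i0 != 0 ->
  (forall j, (j.+1 < D)%N -> \sum_i f i * e i ^+ j = 0) ->
  (D <= #|[pred i | f i != 0%R]|)%N.
Proof.
move=> inj_e fi0 H; rewrite leqNgt; apply/negP => lt_D.
pose A := [pred i | f i != 0].
(* The degree is one less than the size of the support [A], so only power sums with j + 1 <= #|A| <
   D enter. *)
pose P := \prod_(i in [predD1 A & i0]) ('X - (e i)%:P).
have szP : size P = #|A|.
  by rewrite /P -big_enum size_prod_XsubC -cardE (cardD1 i0 A) inE fi0.
have : \sum_i f i * P.[e i] = 0.
  under eq_bigr do rewrite horner_coef mulr_sumr.
  rewrite exchange_big big1 // => j _ /=.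
  under eq_bigr do rewrite mulrCA.
  rewrite -mulr_sumr H ?mulr0 //.
  by apply: leq_ltn_trans lt_D; rewrite -szP.
rewrite (bigD1 i0) //= big1 ?addr0 => [/eqP|i ii0].
  rewrite mulf_eq0 (negPf fi0) horner_prod prodf_seq_eq0 => /hasP[i _].
  rewrite inE /= => /andP[/andP[ii0 _]].
  by rewrite !hornerE subr_eq0 => /eqP/inj_e E; rewrite E eqxx in ii0.
apply/eqP; rewrite mulf_eq0; have [//|fi] := eqVneq (f i) 0.
rewrite horner_prod (bigD1 i) ?inE /= ?ii0 ?fi //=.
by rewrite !hornerE subrr mul0r eqxx.
Qed.

(** * Extended codes as codes of functions on points of [L] *)

Section Points.
Variables (L : finFieldType) (alpha : L) (q n : nat).
Hypothesis prim : (Nlen q n).-primitive_root alpha.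

(** Coordinate locators: the powers of [alpha], and 0 for the appended coordinate. *)
Definition point (i : 'I_(Nlen q n).+1) : L :=
  oapp (fun j : 'I_(Nlen q n) => alpha ^+ j) 0 (unlift ord_max i).

Lemma point_lift (i : 'I_(Nlen q n)) : point (lift ord_max i) = alpha ^+ i.
Proof. by rewrite /point liftK. Qed.

Lemma point_max : point ord_max = 0.
Proof. by rewrite /point unlift_none. Qed.

Lemma point_inj : injective point.
Proof.
have a0 (i : 'I_(Nlen q n)) : alpha ^+ i != 0.
  rewrite expf_neq0 //; apply/eqP => a0; have := prim_expr_order prim.
  by rewrite a0 expr0n gtn_eqF ?(prim_order_gt0 prim) // => /eqP; rewrite eq_sym oner_eq0.
move=> i j; case: (unliftP ord_max i) => [i'|] ->; case: (unliftP ord_max j) => [j'|] -> //;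
  rewrite ?point_lift ?point_max.
- move/eqP; rewrite (eq_prim_root_expr prim) !modn_small // => /eqP E.
  by congr lift; apply: val_inj.
- by move/eqP; rewrite (negPf (a0 _)).
- by move/esym/eqP; rewrite (negPf (a0 _)).
Qed.

Lemma sum_lift_max (F : 'I_(Nlen q n).+1 -> L) :
  \sum_i F i = \sum_(i < Nlen q n) F (lift ord_max i) + F ord_max.
Proof.
rewrite big_ord_recr; congr (_ + _); apply: eq_bigr => i _; congr F.
by apply: val_inj; exact/esym/lift_max.
Qed.

Lemma extend_lift (c : {ffun 'I_(Nlen q n) -> L}) i : extend c (lift ord_max i) = c i.
Proof. by rewrite ffunE liftK. Qed.

Lemma extend_max (c : {ffun 'I_(Nlen q n) -> L}) :
  extend c ord_max = - \sum_j c j.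
Proof. by rewrite ffunE unlift_none. Qed.

(** Since 0^0 = 1, the check at j = 0 says that all coordinates sum to zero, which defines the
    appended one; for j > 0 the point 0 contributes nothing. *)
Lemma extended_code_check (Z : pred L) x (j : nat) :
  extended_code Z x -> (0 < j)%N ==> Z (alpha ^+ j) ->
  \sum_i x i * point i ^+ j = 0.
Proof.
case/existsP => c /andP[/andP[_ /forallP cZ] /eqP->]; rewrite sum_lift_max.
rewrite point_max extend_max.
under eq_bigr do rewrite extend_lift point_lift.
case: j => [_|j /implyP/(_ isT)Zj].
  by rewrite mulr1; under eq_bigr do rewrite mulr1; rewrite subrr.
have /implyP/(_ Zj)/eqP := cZ (alpha ^+ j.+1).
by under eq_bigr do rewrite exprAC; rewrite expr0n mulr0 addr0.
Qed.

Lemma extended_codeP (Z : pred L) (f : L -> L) :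
  (forall x, f x ^+ q = f x) ->
  (forall b, Z b -> exists2 j, (0 < j)%N & b = alpha ^+ j /\
                     \sum_i f (point i) * point i ^+ j = 0) ->
  \sum_i f (point i) = 0 ->
  extended_code Z [ffun i => f (point i)].
Proof.
move=> fF fZ f0; apply/existsP; exists [ffun i => f (point (lift ord_max i))].
apply/andP; split; last first.
  apply/eqP/ffunP => i; rewrite ffunE.
  case: (unliftP ord_max i) => [j|] ->; first by rewrite extend_lift ffunE.
  rewrite extend_max; under eq_bigr do rewrite ffunE.
  by move: f0; rewrite sum_lift_max addrC => /eqP; rewrite addr_eq0 => /eqP.
apply/andP; split; first by apply/forallP => i; rewrite /inFq ffunE fF.
apply/forallP => b; apply/implyP => /fZ[j j0 [->]].
rewrite sum_lift_max point_max expr0n gtn_eqF // mulr0 addr0 => H.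
by apply/eqP; rewrite -[RHS]H; apply: eq_bigr => i _; rewrite ffunE point_lift exprAC.
Qed.

(** The checks pass from both words to their difference, whose support the BCH bound measures. *)
Lemma hamming_ge (C : pred {ffun 'I_(Nlen q n).+1 -> L}) x y D :
  C x -> C y -> y != x ->
  (forall z j, C z -> (j.+1 < D)%N -> \sum_i z i * point i ^+ j = 0) ->
  (D <= hamming x y)%N.
Proof.
move=> Cx Cy xy H; have [i0 d0] : exists i, x i != y i.
  apply/existsP; apply: contraNT xy => /existsPn E; apply/eqP/ffunP => i.
  by apply/esym/eqP; have := E i; rewrite negbK.
have -> : hamming x y = #|[pred i | x i - y i != 0]|.
  by apply: eq_card => i; rewrite !inE subr_eq0.
apply: (@bch_bound _ _ point (fun i => x i - y i) D i0 point_inj).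
  by rewrite subr_eq0.
move=> j ltj; under eq_bigr do rewrite mulrBl.
by rewrite sumrB !H // subrr.
Qed.

End Points.

(** * The subfield of q elements and its power sums *)

Section Subfield.
Variables (p l n : nat) (L : finFieldType) (alpha : L).
Let q := (p ^ l)%N.
Hypotheses (p_pr : prime p) (q_gt1 : (1 < q)%N).
Hypotheses (cardL : #|L| = (q ^ n)%N) (prim : ((q ^ n).-1).-primitive_root alpha).

Definition Fq : {set L} := [set t | t ^+ q == t].

Let pcharL : p \in [pchar L].
Proof. by apply: (@card_finPcharP L p (l * n)) => //; rewrite cardL expnM. Qed.

Lemma FqP t : reflect (t ^+ q = t) (t \in Fq).
Proof. by rewrite inE; apply: eqP. Qed.

Lemma pcharnat_q e : [pchar L].-nat (q ^ e)%N.
Proof. by rewrite pnatX /q pnatX pnatE // pcharL. Qed.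

Lemma exprD_q e (x y : L) : (x + y) ^+ (q ^ e) = x ^+ (q ^ e) + y ^+ (q ^ e).
Proof. exact: exprDn_pchar (pcharnat_q e). Qed.

Lemma Fq0 : 0 \in Fq.
Proof. by apply/FqP; rewrite expr0n gtn_eqF // ltnW. Qed.

Lemma Fq1 : 1 \in Fq.
Proof. by apply/FqP; rewrite expr1n. Qed.

Lemma FqD x y : x \in Fq -> y \in Fq -> x + y \in Fq.
Proof. by move=> /FqP Ex /FqP Ey; apply/FqP; rewrite -[in LHS](expn1 q) exprD_q expn1 Ex Ey. Qed.

Lemma FqM x y : x \in Fq -> y \in Fq -> x * y \in Fq.
Proof. by move=> /FqP Ex /FqP Ey; apply/FqP; rewrite exprMn Ex Ey. Qed.

Lemma FqV x : x \in Fq -> x^-1 \in Fq.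
Proof. by move=> /FqP Ex; apply/FqP; rewrite exprVn Ex. Qed.

Lemma FqN x : x \in Fq -> - x \in Fq.
Proof.
(* Additivity of Frobenius on -x + x avoids a split on the characteristic. *)
move=> /FqP Ex; apply/FqP/eqP; rewrite -subr_eq0 opprK -{2}Ex -{1 2}(expn1 q).
by rewrite -exprD_q addNr expn1 expr0n gtn_eqF // ltnW.
Qed.

Lemma FqX t e : t \in Fq -> t ^+ (q ^ e) = t.
Proof.
move=> /FqP Et; elim: e => [|e IH]; first by rewrite expr1.
by rewrite expnS exprM Et.
Qed.

Lemma Fq_prim : exists2 g, g \in Fq & q.-1.-primitive_root g.
Proof.
(* The witness is [alpha] to the power (q^n-1)/(q-1). *)
have := dvdn_prim_root prim (dvdn_pred_predX q n).
set g := _ ^+ _ => gP; exists g => //; apply/FqP.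
by rewrite -(ltn_predK q_gt1) exprS prim_expr_order // mulr1.
Qed.

(** At most q elements, as roots of X^q - X; at least q, namely 0 and the q-1 powers of a primitive
    root. *)
Lemma card_Fq : #|Fq| = q.
Proof.
apply/eqP; rewrite eqn_leq; apply/andP; split.
  have szP : size ('X^q - 'X : {poly L}) = q.+1.
    by rewrite size_polyDl size_polyXn // size_polyN size_polyX.
  rewrite cardE -ltnS -szP; apply: max_poly_roots; last exact: enum_uniq.
    by rewrite -size_poly_eq0 szP.
  apply/allP => t; rewrite mem_enum => /FqP Et.
  by rewrite rootE !hornerE Et subrr.
have [g gF gP] := Fq_prim.
pose h (o : option 'I_q.-1) := if o is Some i then g ^+ i else 0.
have gi0 (i : 'I_q.-1) : g ^+ i != 0.
  rewrite expf_neq0 //; apply/eqP => g0; have := prim_expr_order gP.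
  by rewrite g0 expr0n gtn_eqF ?(prim_order_gt0 gP) // => /eqP; rewrite eq_sym oner_eq0.
have inj_h : injective h.
  move=> [i|] [j|] //= => [/eqP|/eqP|/esym/eqP]; rewrite ?(negPf (gi0 _)) //.
  rewrite (eq_prim_root_expr gP) !modn_small // => /eqP E.
  by congr Some; apply: val_inj.
have <- : #|{: option 'I_q.-1}| = q by rewrite card_option card_ord (ltn_predK q_gt1).
rewrite -(card_codom inj_h); apply: subset_leq_card; apply/subsetP => _ /codomP[[i|] ->] /=.
  by apply/FqP; rewrite exprAC; congr (_ ^+ _); apply/FqP.
exact: Fq0.
Qed.

(** For j = 0 the sum is q times 1, zero in characteristic p. For j > 0, multiplication by a
    generator g permutes [Fq] and scales the sum by g^j, which differs from 1. *)
Lemma sum_expr_Fq j : (j < q - 1)%N -> \sum_(t in Fq) t ^+ j = 0.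
Proof.
case: j => [_|j ltj].
  rewrite (eq_bigr (fun=> 1)) => [|t _]; last by rewrite expr0.
  rewrite sumr_const card_Fq; apply/eqP; rewrite -(dvdn_pcharf pcharL) /q.
  by case: l @q q_gt1 => [//|l'] _ _; rewrite expnS dvdn_mulr.
have [g gF gP] := Fq_prim.
have g0 : g != 0.
  apply/eqP => g0; have := prim_expr_order gP.
  by rewrite g0 expr0n gtn_eqF ?(prim_order_gt0 gP) // => /eqP; rewrite eq_sym oner_eq0.
have E : g ^+ j.+1 * (\sum_(t in Fq) t ^+ j.+1) = \sum_(t in Fq) t ^+ j.+1.
  rewrite [RHS](reindex_inj (mulfI g0)) mulr_sumr /=.
  apply: eq_big => [t|t _]; last by rewrite exprMn.
  apply/idP/idP => Ft; first exact: FqM.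
  by rewrite -(mulKf g0 t) FqM ?FqV.
have /eqP := E; rewrite -subr_eq0 -{2}[\sum_(_ in _) _]mul1r -mulrBl mulf_eq0.
case/orP => [|/eqP//]; rewrite subr_eq0 -(expr0 g) (eq_prim_root_expr gP).
by rewrite !modn_small //; lia.
Qed.

Lemma sum_horner_Fq (g : {poly L}) : (size g <= q - 1)%N -> \sum_(t in Fq) g.[t] = 0.
Proof.
move=> szg; under eq_bigr do rewrite horner_coef.
rewrite exchange_big big1 //= => j _.
by rewrite -mulr_sumr sum_expr_Fq ?mulr0 // (leq_trans (ltn_ord j)).
Qed.

(* As x ^+ u is a product of wtq u Frobenius powers x ^+ (q ^ e), vanishing W D
   says that x ^+ u sums to 0 over W whenever u has weight less than D. *)
Definition vanishing (W : {set L}) (D : nat) := forall es : seq nat,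
  (size es < D)%N -> \sum_(w in W) \prod_(e <- es) w ^+ (q ^ e) = 0.

(* Expanding one factor (w + t * b) ^+ (q ^ e) = w ^+ (q ^ e) + t * b ^+ (q ^ e)
   either enlarges es1 or multiplies g by 'X. *)
Lemma vanishing_translates W D (b : L) es2 es1 (g : {poly L}) :
  vanishing W D -> (size g + size es1 + size es2 <= D + (q - 1))%N ->
  \sum_(t in Fq) g.[t] * \sum_(w in W)
     ((\prod_(e <- es1) w ^+ (q ^ e)) * \prod_(e <- es2) (w + t * b) ^+ (q ^ e)) = 0.
Proof.
move=> WD; elim: es2 es1 g => [|e es2 IH] es1 g le_sz.
  under eq_bigr do under eq_bigr do rewrite big_nil mulr1.
  (* The sum over [Fq] vanishes if [g] has low degree; otherwise [es1] is shorter than [D] and the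
     sum over [W] vanishes. *)
  rewrite -mulr_suml; have [szg|szg] := leqP (size g) (q - 1).
    by rewrite sum_horner_Fq ?mul0r.
  rewrite WD ?mulr0 //; move: le_sz szg; rewrite addn0. move: (size g) (size es1) => a c; lia.
have E1 := IH (e :: es1) g; have E2 := IH es1 (g * 'X).
rewrite -[RHS]addr0 -[X in X + _]E1 -1?[X in _ + X](mulr0 (b ^+ (q ^ e))).
  rewrite -[X in _ * X]E2 ?mulr_sumr -?big_split /=; last first.
    by move: le_sz (size_polyMleq g 'X); rewrite size_polyX /=; lia.
  apply: eq_bigr => t Ft; rewrite hornerM hornerX !mulr_sumr -big_split /=.
  apply: eq_bigr => w _; rewrite !big_cons exprD_q exprMn (FqX _ Ft).
  ring.
by move: le_sz => /=; lia.
Qed.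

(** * Subspaces over the subfield and low-weight functions *)

Definition Fq_subspace (W : {set L}) :=
  0 \in W /\ forall x y t, x \in W -> y \in W -> t \in Fq -> x + t * y \in W.

Lemma Fq_subspaceZ W x t : Fq_subspace W -> x \in W -> t \in Fq -> t * x \in W.
Proof. by case=> W0 H Wx Ft; rewrite -[_ * _]add0r H. Qed.

(** The coordinate of [x] along [b] modulo [W] is well defined: otherwise (t - t') b, hence [b],
    would lie in [W]. *)
Lemma Fq_subspace_uniq W b x t t' : Fq_subspace W -> b \notin W ->
  t \in Fq -> t' \in Fq -> x - t * b \in W -> x - t' * b \in W -> t = t'.
Proof.
move=> HW Nb Ft Ft' Wt Wt'; apply/eqP; apply: contraNT Nb; rewrite -subr_eq0 => tt'.
have : x - t' * b + (-1) * (x - t * b) \in W by apply: HW.2; rewrite ?FqN ?Fq1.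
have -> : x - t' * b + (-1) * (x - t * b) = (t - t') * b.
  by rewrite mulN1r mulrBl opprB addrC addrA subrK.
move/(Fq_subspaceZ HW (t := (t - t')^-1)); rewrite mulKf //; apply.
by rewrite FqV // FqD // FqN.
Qed.

Lemma card_ltn_notin (W : {set L}) k :
  #|W| = (q ^ k)%N -> (k < n)%N -> exists b, b \notin W.
Proof.
move=> cW ltk; apply/existsP; rewrite -negb_forall; apply/negP => /forallP WT.
have : (q ^ k < q ^ n)%N by rewrite ltn_exp2l.
by rewrite -cW -cardL ltnNge => /negP[]; apply/subset_leq_card/subsetP.
Qed.

(** One direction [b] is added at a time; summing over the translates by multiples of [b] raises the
    vanishing bound by q-1. *)
Lemma subspace_exists k : (k <= n)%N ->
  exists W, [/\ Fq_subspace W, #|W| = (q ^ k)%N & vanishing W (k * (q - 1))].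
Proof.
elim: k => [_|k IH ltk].
  exists [set 0]; split => //; last by rewrite cards1.
  by split=> [|x y t /set1P-> /set1P-> _]; rewrite ?mulr0 ?addr0 set11.
have [W [HW cW vW]] := IH (ltnW ltk).
have [b Nb] := card_ltn_notin cW ltk.
pose h (x : L * L) := x.1 + x.2 * b.
have inj_h : {in setX W Fq &, injective h}.
  move=> [w t] [w' t'] /setXP[/= Ww Ft] /setXP[/= Ww' Ft'] E.
  have Et : t = t'.
    by apply: (Fq_subspace_uniq (x := h (w, t)) HW Nb) => //;
      rewrite ?[X in X - t' * b]E /h /= addrK.
  by rewrite Et in E *; move/addIr: E => /= ->.
exists (h @: setX W Fq); split.
- split; first by apply/imsetP; exists (0, 0); rewrite ?in_setX ?HW.1 ?Fq0 //= /h mul0r addr0.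
  move=> _ _ c /imsetP[[w t] /setXP[/= Ww Ft] ->] /imsetP[[w' t'] /setXP[/= Ww' Ft'] ->] Fc.
  apply/imsetP; exists (w + c * w', t + c * t').
    by rewrite in_setX /= HW.2 ?FqD ?FqM.
  by rewrite /h /= mulrDr mulrDl addrACA mulrA.
- by rewrite card_in_imset // cardsX cW card_Fq expnSr.
move=> es szes; rewrite big_imset //=.
rewrite (eq_bigl (fun x => (x.1 \in W) && (x.2 \in Fq))); last by case=> w t; rewrite in_setX.
rewrite -(pair_big (mem W) (mem Fq)
            (fun w t => \prod_(e <- es) (w + t * b) ^+ (q ^ e))) exchange_big /=.
rewrite -[RHS](@vanishing_translates W (k * (q - 1)) b es [::] 1 vW); last first.
  by move: szes; rewrite size_poly1 addn0 mulSn; lia.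
apply: eq_bigr => t _; rewrite hornerE mul1r; apply: eq_bigr => w _.
by rewrite big_nil mul1r.
Qed.

(** With [g] of size s + 1 and [es1] empty, the length condition on [es] is exactly that of
    [vanishing_translates]. *)
Lemma low_weight_function k s : (k < n)%N -> (s < q)%N ->
  exists f : L -> L, [/\ forall x, f x ^+ q = f x,
    exists x, f x != 0, (#|[pred x | f x != 0%R]| <= (q - s) * q ^ k)%N &
    forall es : seq nat, (size es + s + 1 <= k.+1 * (q - 1))%N ->
      \sum_x f x * \prod_(e <- es) x ^+ (q ^ e) = 0].
Proof.
move=> ltk lts; have [W [HW cW vW]] := subspace_exists (ltnW ltk).
have [b Nb] := card_ltn_notin cW ltk.
have [A AF cA] : exists2 A : {set L}, A \subset Fq & #|A| = s.
  exists [set x in take s (enum Fq)].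
    by apply/subsetP => x; rewrite inE => /mem_take; rewrite mem_enum.
  rewrite cardsE; have /card_uniqP -> := take_uniq s (enum_uniq Fq).
  by rewrite size_take -cardE card_Fq lts.
pose g : {poly L} := \prod_(a in A) ('X - a%:P).
have szg : size g = s.+1 by rewrite /g -big_enum size_prod_XsubC -cardE cA.
have gF t : t \in Fq -> g.[t] \in Fq.
  move=> Ft; rewrite horner_prod; elim/big_ind: _ => [||a Aa]; first exact: Fq1.
    exact: FqM.
  by rewrite !hornerE FqD ?FqN // (subsetP AF).
have g0 t : (g.[t] == 0) = (t \in A).
  by rewrite -rootE /g -big_enum root_prod_XsubC mem_enum.
(* At most one t contributes, so [f] is g(t) on the coset W + t b and 0 off these cosets. *)
pose f x := \sum_(t in Fq | x - t * b \in W) g.[t].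
have fE x t : t \in Fq -> x - t * b \in W -> f x = g.[t].
  move=> Ft Wt; rewrite /f (bigD1 t) /= ?Ft // big1 ?addr0 // => t' /andP[/andP[Ft' Wt'] /eqP[]].
  exact: (Fq_subspace_uniq HW Nb Ft' Ft Wt' Wt).
exists f; split.
- move=> x; apply/FqP; rewrite /f; elim/big_ind: _ => [||t /andP[/gF]//]; first exact: Fq0.
  exact: FqD.
- have [t Ft At] : exists2 t, t \in Fq & t \notin A.
    apply/subsetPn; apply/negP => /subset_leq_card; rewrite cA card_Fq; lia.
  by exists (t * b); rewrite (fE _ t) ?subrr ?HW.1 // g0.
- have <- : #|setX W (Fq :\: A)| = ((q - s) * q ^ k)%N.
    by rewrite cardsX cW cardsD (setIidPr AF) card_Fq cA mulnC.
  apply: leq_trans (leq_imset_card (fun x : L * L => x.1 + x.2 * b) _).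
  apply: subset_leq_card; apply/subsetP => x; rewrite inE => fx.
  have [/existsP[t /andP[Ft Wt]]|/existsPn N] :=
    boolP [exists t, (t \in Fq) && (x - t * b \in W)].
    apply/imsetP; exists (x - t * b, t); last by rewrite /= subrK.
    by rewrite in_setX in_setD /= Wt Ft -g0 -(fE _ _ Ft Wt) fx.
  by case/eqP: fx; apply: big1 => t Wt; case/negP: (N t).
move=> es szes.
rewrite -[RHS](@vanishing_translates W (k * (q - 1)) b es [::] g vW); last first.
  by move: szes; rewrite szg addn0 mulSn; lia.
under eq_bigr do rewrite mulr_suml big_mkcondr /=.
rewrite exchange_big /=; apply: eq_bigr => t _; rewrite mulr_sumr.
rewrite [LHS](reindex_inj (addIr (t * b))) /= [RHS]big_mkcond.
by apply: eq_bigr => w _; rewrite addrK big_nil mul1r.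
Qed.

End Subfield.

(** Listing each position as often as its digit says turns an integer exponent into a list of
    Frobenius exponents. *)
Lemma expr_digits (R : nzRingType) q k u : (u < q ^ k)%N ->
  exists2 es : seq nat, size es = wtq q k u &
    forall x : R, x ^+ u = \prod_(e <- es) x ^+ (q ^ e).
Proof.
elim: k u => [|k IH] u; first rewrite expn0 ltnS leqn0 => /eqP->.
  by exists [::] => [|x]; rewrite ?big_nil // /wtq big_ord0.
rewrite expnS => ltu; have q0 : (0 < q)%N by rewrite lt0n; apply: contraTneq ltu => ->; rewrite mul0n.
have [|es szes Hes] := IH (u %/ q)%N; first by rewrite ltn_divLR // mulnC.
exists (nseq (u %% q)%N 0%N ++ map S es).
  by rewrite size_cat size_nseq size_map szes wtq_low.
move=> x; rewrite big_cat big_nseq big_map /= expn0 expr1 GRing.iter_mulr_1.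
under eq_bigr do rewrite expnS exprM.
by rewrite -Hes -exprM -exprD; congr (x ^+ _); rewrite addnC mulnC -divn_eq.
Qed.

(** * Lower and upper bounds for the codes *)

Section Distance.
Variables (p l m : nat) (L : finFieldType) (alpha : L) (I : pred nat) (r k s : nat).
Let q := (p ^ l)%N.
Let n := (2 * m)%N.
(** The boundary weight n(q-1) - r: positive exponents of smaller weight always give zeros, those of
    weight [d] subject to [I]. *)
Let d := (k * (q - 1) + (q - 2 - s))%N.
Hypotheses (lt_kn : (k < n)%N) (lt_s : (s < q - 1)%N).
Hypothesis def_r : (r + d = n * (q - 1))%N.

(** The index |O - E| lies in M_r: there are m positions of each parity, and n(q-1) is even, so [d]
    and [r] have the same parity. *)
Lemma inZI_exp j : (0 < j < q ^ n)%N -> (wtq q n j <= d)%N ->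
  (wtq q n j = d -> ~~ I (absdiff (Oq q n j) (Eq q n j))) ->
  inZI alpha q n m r I (alpha ^+ j).
Proof.
move=> /andP[j0 ltj] led NI; apply/orP.
have [Ed|Nd] := eqVneq (wtq q n j) d; last first.
  left; apply/existsP; exists (Ordinal ltj); rewrite /= j0 eqxx andbT /=.
  by move: led Nd def_r; lia.
have q0 : (0 < q)%N by lia.
have [Ole Ele] := OqEq_le n j q0.
have hn : n./2 = m by rewrite /n mul2n doubleK.
have un : uphalf n = m by rewrite /n mul2n uphalf_double.
rewrite hn in Ole; rewrite un in Ele.
right; have ltK : (absdiff (Oq q n j) (Eq q n j) < (m * (q - 1)).+1)%N.
  by rewrite /absdiff; lia.
apply/existsP; exists (Ordinal ltK); rewrite NI // andbT; apply/andP; split.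
  rewrite /inM /= -ltnS ltK /=; apply/eqP.
  have : odd (r + d) = false by rewrite def_r /n -mulnA oddM.
  by rewrite -Ed wtq_OqEq oddD odd_absdiff; case: (odd r); case: (odd _).
by apply/existsP; exists (Ordinal ltj); rewrite /= !eqxx !andbT -def_r addKn Ed.
Qed.

Hypothesis prim : (Nlen q n).-primitive_root alpha.

Lemma mindist_Cq_ge D : (D <= (q - s) * q ^ k)%N ->
  (forall j, (j.+1 < D)%N -> wtq q n j = d -> ~~ I (absdiff (Oq q n j) (Eq q n j))) ->
  (D <= mindist (Cq alpha q m r I))%N.
Proof.
move=> leD NI.
(* Used twice: for the default value of [mindist] and for the range of exponents. *)
have leDn : (D <= q ^ n)%N.
  apply: (leq_trans leD); apply: (@leq_trans (q ^ k.+1)).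
    by rewrite expnS leq_mul2r leq_subr orbT.
  by rewrite leq_pexp2l //; lia.
apply/mindist_geP; split=> [|x y Cx Cy xy]; first by rewrite (leq_trans leDn) // /Nlen leqSpred.
apply: (hamming_ge prim Cx Cy xy) => z j Cz ltj.
apply: (extended_code_check Cz); apply/implyP => j0.
have [led _] := weight_below lt_kn lt_s (leq_trans ltj leD).
apply: inZI_exp => //; last exact: NI.
by rewrite j0 (leq_trans _ leDn) // ltnW.
Qed.

Hypotheses (p_pr : prime p) (cardL : #|L| = (q ^ n)%N).

Lemma mindist_Cq_le : (0 < d)%N -> (mindist (Cq alpha q m r I) <= (q - s) * q ^ k)%N.
Proof.
move=> d0.
have q1 : (1 < q)%N by lia.
have ltsq : (s < q)%N by lia.
have [f [fF [x0 fx0] supp fsum]] := low_weight_function p_pr q1 cardL prim lt_kn ltsq.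
have szN : (Nlen q n).+1 = (q ^ n)%N by rewrite /Nlen prednK // expn_gt0 ltnW.
have [pt' ptK ptK'] : bijective (@point L alpha q n).
  by apply: inj_card_bij (point_inj prim) _; rewrite card_ord szN cardL.
have fcheck u : (u < q ^ n)%N -> (wtq q n u <= d)%N ->
    \sum_i f (@point L alpha q n i) * @point L alpha q n i ^+ u = 0 :> L.
  move=> ltu leu; have [es szes Hes] := expr_digits L ltu.
  rewrite -[RHS](fsum es); last by rewrite szes mulSn; move: leu; rewrite /d; lia.
  rewrite [RHS](reindex (@point L alpha q n)) /=; last by exists pt' => ? _.
  by apply: eq_bigr => i _; rewrite Hes.
(* Positivity of [d] excludes the exponent 0 from the weight-[d] part. *)
have Zwt b : inZI alpha q n m r I b ->
    exists2 u, (u < q ^ n)%N && (wtq q n u <= d)%N & (0 < u)%N /\ b = alpha ^+ u.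
  case/orP => [/existsP[u /andP[/andP[u0 le_u] /eqP->]]|].
    by exists (u : nat); rewrite // ltn_ord /=; move: le_u def_r; lia.
  case/existsP => j /andP[_ /existsP[u /andP[/andP[/eqP wt_u _] /eqP->]]].
  exists (u : nat); first by rewrite ltn_ord wt_u -def_r addKn /=.
  split=> //; rewrite lt0n; apply/eqP => u0; move: wt_u.
  rewrite u0 /wtq big1 => [|i _]; last by rewrite /digit div0n mod0n.
  by move=> E; move: def_r d0; lia.
have Cf : Cq alpha q m r I [ffun i => f (@point L alpha q n i)].
  apply: extended_codeP => // [b /Zwt[u /andP[ltu leu] [u0 ->]]|].
    by exists u => //; split=> //; apply: fcheck.
  rewrite -[RHS](fcheck 0%N); first by apply: eq_bigr => i _; rewrite expr0 mulr1.
    by rewrite expn_gt0 ltnW.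
  by rewrite /wtq big1 // => i _; rewrite /digit div0n mod0n.
(* The zero word is the second codeword, so the distance is the weight of [f]. *)
have C0 : Cq alpha q m r I [ffun i => (fun=> 0) (@point L alpha q n i)].
  apply: (@extended_codeP _ _ _ _ _ (fun=> 0)) => [x|b /Zwt[u _ [u0 ->]]|].
  - by rewrite expr0n gtn_eqF // ltnW.
  - by exists u => //; split=> //; rewrite big1 // => i _; rewrite mul0r.
  - by rewrite big1.
have /mindist_geP[_ H] := leqnn (mindist (Cq alpha q m r I)).
apply: leq_trans (H _ _ C0 Cf _) _.
  apply: contra fx0 => /eqP/ffunP/(_ (pt' x0)).
  by rewrite !ffunE ptK' => ->.
apply: leq_trans supp.
rewrite /hamming -(card_image (point_inj prim)); apply: subset_leq_card.
apply/subsetP => _ /imageP[i + ->]; rewrite !inE !ffunE.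
by rewrite eq_sym.
Qed.

End Distance.

(* The three cases of the theorem *)
Local Close Scope ring_scope.

Theorem theorem4p2 (p l m : nat) (L : finFieldType) (alpha : L)
    (r rho s : nat) (I : pred nat) :
  prime p -> (0 < m)%N ->
  #|L| = ((p ^ l) ^ (2 * m))%N ->
  (((p ^ l) ^ (2 * m)).-1.-primitive_root alpha)%R ->
  (r + 2 <= (2 * m) * (p ^ l - 1))%N ->
  r = (rho * (p ^ l - 1) + s)%N ->
  (rho <= 2 * m - 1)%N -> (s < p ^ l - 1)%N ->
  (forall k, I k -> inM (p ^ l) m r.+1 k) ->
  [/\ (rho = 2 * m - 1 -> ~~ I (p ^ l - 1 - s - 1) ->
         mindist (Cq alpha (p ^ l) m r.+1 I) = (p ^ l - s)%N),
      ((rho <= 2 * m - 2)%N ->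
         (odd rho && ~~ I (p ^ l - 1 - s + 1) && ~~ I (p ^ l - 1 - s - 1))
         || (~~ odd rho && ~~ I (s + 1) && ~~ I (absdiff s 1)) ->
         mindist (Cq alpha (p ^ l) m r.+1 I)
           = ((p ^ l - s) * (p ^ l) ^ (2 * m - rho - 1))%N)
    & ((rho <= 2 * m - 2)%N ->
         (odd rho && I (p ^ l - 1 - s + 1) && ~~ I (p ^ l - 1 - s - 1))
         || [&& ~~ odd rho, s != 0%N, ~~ I (s + 1) & I (absdiff s 1)] ->
         ((p ^ l) ^ 2 - p ^ l * s - 1) * (p ^ l) ^ (2 * m - rho - 2)
           <= mindist (Cq alpha (p ^ l) m r.+1 I))%N].
Proof.
move=> p_pr m0 cardL prim ler def_r lerho lts NI.
set q := (p ^ l) in cardL prim ler def_r lts *.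
set n := (2 * m) in cardL prim ler def_r lerho *.
pose k := (n - rho - 1).
have [e1 e2] : q - 1 - s + 1 = q - s /\ q - 1 - s - 1 = q - 2 - s.
  by move: lts; clear; lia.
have lt1q : 1 < q by move: lts; clear; lia.
have def_n : n = rho + k.+1 by move: m0 lerho; rewrite /k /n; clear; lia.
have lt_kn : k < n by rewrite def_n leq_addl.
have odd_k : odd k = ~~ odd rho.
  have : odd n = false by rewrite /n oddM.
  by rewrite def_n oddD /=; case: (odd rho); case: (odd k).
have def_rk : (r.+1 + (k * (q - 1) + (q - 2 - s)) = n * (q - 1)).
  by rewrite def_r def_n mulnDl mulSn; move: lts; clear; lia.
have le_dist : (mindist (Cq alpha q m r.+1 I) <= (q - s) * q ^ k).
  apply: (mindist_Cq_le _ lt_kn lts def_rk prim p_pr cardL).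
  by rewrite -(ltn_add2l r.+1) def_rk addn0 -addn2.
have ge_dist := mindist_Cq_ge lt_kn lts def_rk prim.
(* The parity of [k], opposite to that of [rho], decides which two values occur. For k = 0 there is
   no lower digit, so q - s does not occur. *)
have exact_dist :
    (if odd k then ~~ I (s + 1) && ~~ I (absdiff s 1)
     else ~~ I (q - 2 - s) && ((k == 0) || ~~ I (q - s))) ->
    mindist (Cq alpha q m r.+1 I) = ((q - s) * q ^ k).
  move=> Hk; apply/eqP; rewrite eqn_leq le_dist; apply: ge_dist => // j ltj wtj.
  have [_ /(_ wtj)[|[Hj]]] := weight_below lt_kn lts ltj.
    by case: (odd k) Hk => /andP[H1 H2] ->.
  move: Hk; case: (odd k) => [/andP[H1 H2]|/andP[H1 /orP[/eqP k0|H2]]] -> //.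
  move: Hj; rewrite leqNgt => /negP[]; rewrite k0 expn0 in ltj *.
  by apply: (leq_trans _ (leq_mul (leqnn q) ltj)); rewrite [leqRHS]mulnS addnC ltn_add2r.
split.
- move=> Erho NIs; have k0 : k = 0 by move: Erho; rewrite /k /n; clear; lia.
  by rewrite exact_dist k0 ?expn0 ?muln1 //= andbT -e2.
- move=> _ H; apply: exact_dist; move: H; rewrite odd_k e1 e2.
  case: (odd rho) => /=; rewrite ?orbF //.
  by case/andP => -> ->; rewrite orbT.
move=> lerho2 H.
have k0 : 0 < k by move: lerho2 m0; rewrite /k /n; clear; lia.
have Eqk : q ^ k = q * q ^ k.-1 by rewrite -expnS prednK.
(* In this form the bound ends the run just before U - q^(k-1), where U = (q - s) q^k - 1. *)
have -> : (q ^ 2 - q * s - 1) * q ^ (n - rho - 2) = (q - s) * q ^ k - q ^ k.-1.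
  have -> : n - rho - 2 = k.-1 by rewrite /k; clear; lia.
  by rewrite Eqk -mulnn -mulnBr mulnBl mul1n mulnA [(q - s) * q]mulnC.
apply: ge_dist => [|j ltj wtj]; first exact: leq_subr.
have ltj' := leq_trans ltj (leq_subr _ _).
have [_ /(_ wtj)[|[Hj _]]] := weight_below lt_kn lts ltj'.
  move: H; rewrite odd_k e2; case: (odd rho) => /=; rewrite ?orbF.
    by case/andP=> _ NIs ->.
  by case/and3P => _ NIs _ ->.
(* After cancelling q, the second alternative makes j + 1 at least the claimed bound. *)
move: Hj; rewrite [X in _ + X]Eqk -mulnDr leq_pmul2l ?(ltnW lt1q) // leqNgt.
by rewrite -ltn_subRL ltn_subRL addnC -ltn_subRL ltj.
Qed.
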